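(* Suppose $\mathcal L$ is convex-concave over $\mathcal X\times\mathcal Y$. Let $\{x_t,y_t\}_{t\ge0}$ be the sequence generated by the LMO-PO algorithm (described in the context) with $\tau_t=(t+1)^{-a}$ and $\beta_t=C(t+1)^{-b}$ (where $C>0$ is any constant), or $\beta_t=0$ where indicated. The following hold for every $T\ge1$, with constants hidden in $O(\cdot)$, $\widetilde O(\cdot)$ independent of $T$. (i) (Convex-concave.) If the standing assumption holds and $a=1$, $b=\frac13$, then $$G^{\mathrm{Opt}}_{\mathcal X}(x_T)\le\widetilde O(T^{-1/3}),\qquad \frac1T\sum_{t=1}^TG_{\mathcal Y}(x_t,y_t)\le O(T^{-1/3}).$$ (ii) (Convex-strongly concave.) If the standing assumption holds with $\mu>0$, and $a=1$, $\beta_t=0$ for all $t$, then $$G^{\mathrm{Opt}}_{\mathcal X}(x_T)\le\widetilde O(T^{-1}),\qquad \frac1T\sum_{t=1}^TG_{\mathcal Y}(x_t,y_t)\le O(T^{-1}).$$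
   Context: Notation: $\|\cdot\|$ is the Euclidean norm; $\widetilde O$ suppresses factors polynomial in $\log(T+2)$. Standing assumption. $\mathcal X\subset\mathbb R^{d_x}$ and $\mathcal Y\subset\mathbb R^{d_y}$ are nonempty compact convex sets with diameters $D_{\mathcal X}$, $D_{\mathcal Y}$. The payoff $\mathcal L:\mathbb R^{d_x}\times\mathbb R^{d_y}\to\mathbb R$ is continuously differentiable on an open set containing $\mathcal X\times\mathcal Y$; for some $\mu\ge 0$ and every $x\in\mathcal X$, $\mathcal L(x,\cdot)$ is $\mu$-strongly concave on $\mathcal Y$ ($\mu=0$ meaning concave); and there are $L_{xx},L_{yy}\ge 0$, $L_{yx}>0$ such that for all $(x,y),(x',y')\in\mathcal X\times\mathcal Y$, $\|\nabla_x\mathcal L(x,y)-\nabla_x\mathcal L(x',y')\|\le L_{xx}\|x-x'\|+L_{yx}\|y-y'\|$ and $\|\nabla_y\mathcal L(x,y)-\nabla_y\mathcal L(x',y')\|\le L_{yx}\|x-x'\|+L_{yy}\|y-y'\|$. Gaps: $f(x)=\max_{y\in\mathcal Y}\mathcal L(x,y)$; $G^{\mathrm{Opt}}_{\mathcal X}(x)=f(x)-\min_{v\in\mathcal X}f(v)$; $G_{\mathcal Y}(x,y)=\max_{u\in\mathcal Y}\mathcal L(x,u)-\mathcal L(x,y)$. Oracles: $\mathrm{LMO}_{\mathcal U}(d)$ denotes an arbitrary element of $\arg\min_{v\in\mathcal U}d^\top v$; $\mathrm{PO}_{\mathcal U}(u)=\arg\min_{v\in\mathcal U}\|u-v\|^2$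 is Euclidean projection. Regularized payoff: $\mathcal L_\beta(x,y)=\mathcal L(x,y)-\frac{\beta}{2}\|y-y_0\|^2$, where $y_0\in\mathcal Y$ is the initial dual iterate. LMO-PO algorithm: start from $x_0\in\mathcal X$, $y_0\in\mathcal Y$; for $t=0,1,2,\dots$: $v_t=\mathrm{LMO}_{\mathcal X}(\nabla_x\mathcal L(x_t,y_t))$, $x_{t+1}=x_t+\tau_t(v_t-x_t)$; $\gamma_t=\frac{1}{L_{yy}+\beta_t}$, $y_{t+1}=\mathrm{PO}_{\mathcal Y}(y_t+\gamma_t\nabla_y\mathcal L_{\beta_t}(x_t,y_t))$. *)

(* Defs.v *)
From HB Require Import structures.
From mathcomp Require Import all_boot all_order all_algebra.
From mathcomp Require Import all_classical all_reals all_analysis.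

Set Implicit Arguments.
Unset Strict Implicit.
Unset Printing Implicit Defensive.

Import Order.TTheory GRing.Theory Num.Theory.
Import numFieldNormedType.Exports.

Local Open Scope classical_set_scope.
Local Open Scope ring_scope.

Section Definitions.
Context {R : realType}.

Definition dot n (u v : 'rV[R]_n) : R := (u *m v^T) 0 0.

(* The library norm `|v| on 'rV[R]_n is the sup norm. *)
Definition enorm n (v : 'rV[R]_n) : R := Num.sqrt (dot v v).

Definition grad n (g : 'rV[R]_n -> R) (x : 'rV[R]_n) : 'rV[R]_n :=
  \row_(i < n) 'D_(delta_mx 0 i) g x.

Definition argmin n (U : set 'rV[R]_n) (g : 'rV[R]_n -> R) : set 'rV[R]_n :=
  [set v | U v /\ forall w, U w -> g v <= g w].

Definition LMO n (U : set 'rV[R]_n) (d : 'rV[R]_n) : set 'rV[R]_n :=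
  argmin U (fun v => dot d v).

Definition PO n (U : set 'rV[R]_n) (u : 'rV[R]_n) : set 'rV[R]_n :=
  argmin U (fun v => enorm (u - v) ^+ 2).

Definition strongly_concave n (mu : R) (U : set 'rV[R]_n)
    (g : 'rV[R]_n -> R) : Prop :=
  forall (u v : 'rV[R]_n) (s : R), U u -> U v -> 0 <= s <= 1 ->
    s * g u + (1 - s) * g v + mu / 2 * s * (1 - s) * enorm (u - v) ^+ 2
      <= g (s *: u + (1 - s) *: v).

(* In finite dimension, continuity of the derivative as a map into linear
   forms amounts to continuity of its value in every fixed direction. *)
Definition continuously_differentiable_on (V : normedModType R) (U : set V)
    (g : V -> R) : Prop :=
  forall z, U z ->
    differentiable g z /\
    forall v, {for z, continuous (fun w => 'd g w v)}.

Section Payoff.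
Variables (dx dy : nat).
Variables (X : set 'rV[R]_dx) (Y : set 'rV[R]_dy).
Variable L : 'rV[R]_dx -> 'rV[R]_dy -> R.

Definition grad_x (x : 'rV[R]_dx) (y : 'rV[R]_dy) : 'rV[R]_dx :=
  grad (fun x' => L x' y) x.

Definition grad_y (x : 'rV[R]_dx) (y : 'rV[R]_dy) : 'rV[R]_dy :=
  grad (L x) y.

Record standing_assumption (mu Lxx Lyy Lyx : R) : Prop := {
  X_nonempty : X !=set0;
  X_compact : compact X;
  X_convex : convex_set X;
  Y_nonempty : Y !=set0;
  Y_compact : compact Y;
  Y_convex : convex_set Y;
  L_C1 : exists U : set ('rV[R]_dx * 'rV[R]_dy)%type,
    [/\ open U, X `*` Y `<=` U &
        continuously_differentiable_on U (fun z => L z.1 z.2)];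
  mu_ge0 : 0 <= mu;
  L_strongly_concave : forall x, X x -> strongly_concave mu Y (L x);
  Lxx_ge0 : 0 <= Lxx;
  Lyy_ge0 : 0 <= Lyy;
  Lyx_gt0 : 0 < Lyx;
  grad_x_lipschitz : forall x x' y y', X x -> X x' -> Y y -> Y y' ->
    enorm (grad_x x y - grad_x x' y')
      <= Lxx * enorm (x - x') + Lyx * enorm (y - y');
  grad_y_lipschitz : forall x x' y y', X x -> X x' -> Y y -> Y y' ->
    enorm (grad_y x y - grad_y x' y')
      <= Lyx * enorm (x - x') + Lyy * enorm (y - y') }.

Definition convex_concave : Prop :=
  (forall y, Y y -> convex_function X (fun x => L x y)) /\
  (forall x, X x -> convex_function Y (fun y => - L x y)).

(* Maxima and minima are written as sup and inf; under the standing assumption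
   they are attained, by compactness. *)
Definition primal (x : 'rV[R]_dx) : R := sup [set L x y | y in Y].

Definition gap_opt (x : 'rV[R]_dx) : R :=
  primal x - inf [set primal v | v in X].

Definition gap_dual (x : 'rV[R]_dx) (y : 'rV[R]_dy) : R :=
  sup [set L x u | u in Y] - L x y.

Definition regularized (y0 : 'rV[R]_dy) (b : R)
    (x : 'rV[R]_dx) (y : 'rV[R]_dy) : R :=
  L x y - b / 2 * enorm (y - y0) ^+ 2.

(* The oracle for X may return any minimizer, so a run of the algorithm is a
   relation on sequences. If Lyy + beta t = 0 then the step size is 0^-1 = 0;
   under the standing assumption with mu > 0 this forces Y to be a singleton,
   so that the value of the step size is irrelevant. *)
Definition lmo_po_run (Lyy : R) (tau beta : nat -> R)
    (x : nat -> 'rV[R]_dx) (y : nat -> 'rV[R]_dy) : Prop :=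
  [/\ X (x 0%N), Y (y 0%N) &
    forall t : nat,
      (exists2 v, LMO X (grad_x (x t) (y t)) v &
                  x t.+1 = x t + tau t *: (v - x t)) /\
      PO Y (y t + (Lyy + beta t)^-1 *:
                  grad (regularized (y 0%N) (beta t) (x t)) (y t))
           (y t.+1)].

End Payoff.

Definition power_decay (a : R) (t : nat) : R := t.+1%:R `^ (- a).

Definition rate_O (u r : nat -> R) : Prop :=
  exists K : R, forall T : nat, (1 <= T)%N -> u T <= K * r T.

Definition rate_Otilde (u r : nat -> R) : Prop :=
  exists (K : R) (k : nat), forall T : nat, (1 <= T)%N ->
    u T <= K * ln (T + 2)%:R ^+ k * r T.

Definition average (u : nat -> R) (T : nat) : R :=
  T%:R^-1 * \sum_(1 <= t < T.+1) u t.

End Definitions.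

(* Main.v *)
Require Import Defs.
From HB Require Import structures.
From mathcomp Require Import all_boot all_order all_algebra.
From mathcomp Require Import all_classical all_reals all_analysis.
From mathcomp Require Import ring lra.

Set Implicit Arguments.
Unset Strict Implicit.
Unset Printing Implicit Defensive.

Import Order.TTheory GRing.Theory Num.Theory.
Import numFieldNormedType.Exports.

Local Open Scope classical_set_scope.
Local Open Scope ring_scope.

(** Why the theorem holds.

    Write L_b for the payoff regularized with weight b, P_b(x) for its maximum
    over y, and m for a modulus of strong concavity of L_b in y (m is b in the
    first regime and mu, with b = 0, in the second). The proof follows two numbers
    along a run: the dual gap g_t = P_b(x_t) - L_b(x_t, y_t), and the primal
    quantity h_t = P_b(x_t) - inf f.

    Dual side. A projected gradient step on the m-strongly concave,
    (Lyy + b)-smooth function L_b(x_t, .) multiplies g_t by at most 1 - s as soon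
    as s (Lyy + b) <= m (projected_gradient_contraction). The following primal
    move from x to x' changes the maximum and the value at y_(t+1) by almost the
    same amount: the two gradients in x differ by Lyx times the distance of
    y_(t+1) to the maximizer, which quadratic growth bounds by the square root of
    2 g / m. Young's inequality absorbs this cross term into half of the
    contraction, so that
      g_(t+1) <= (1 - s/2) g_t + O(tau^2 / (m s)) + O(drift of b)
    (dual_gap_seq_step).

    Primal side. Since tau (v - x) is a Frank-Wolfe direction for the gradient at
    y_t and not at the maximizer, convexity of L in x compares the step with an
    arbitrary competitor w through the value L(w, y_t) <= f(w), at the cost of g_t
    and of the same cross term. This gives
      h_(t+1) <= (1 - tau) h_t + tau O((1 + r) g_t + 1 / (m r)) + tau^2 O(1 / m) + drift
    for every r > 0 (opt_gap_seq_step). With tau = 1 / (t + 1) the numbers t h_t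
    telescope (averaging_recursion).

    Both inequalities come from reg_primal_le_model, the substitute for smoothness
    of P_b: it evaluates L_b at the maximizer for the new x and lets quadratic
    growth pay for the displacement of that maximizer.

    Rates. Put n = t + 1 and p = n^(-1/3). In the first regime m and s are of
    order p and tau = p^3, so that g_t = O(p^3) by perturbed_contraction; r = 1/p^2
    then makes every error in the primal recursion O(tau p), and the average of p
    over times up to T is O(T^(-1/3)). The bias of the regularization is of order
    b, that is, p. In the second regime m and s are constants and g_t = O(1 / n^2),
    which is summable; r = n makes the errors O(1 / n^2), and the harmonic sum is
    the source of the logarithm. *)

(** * Euclidean geometry of row vectors *)

Lemma dotE (R : realType) n (u v : 'rV[R]_n) :
  dot u v = \sum_i u 0 i * v 0 i.
Proof. by rewrite /dot mxE; apply: eq_bigr => i _; rewrite mxE. Qed.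

Lemma dotC (R : realType) n (u v : 'rV[R]_n) : dot u v = dot v u.
Proof. by rewrite !dotE; apply: eq_bigr => i _; rewrite mulrC. Qed.

Lemma dotDl (R : realType) n (u v w : 'rV[R]_n) :
  dot (u + v) w = dot u w + dot v w.
Proof. by rewrite /dot mulmxDl mxE. Qed.

Lemma dotNl (R : realType) n (u w : 'rV[R]_n) : dot (- u) w = - dot u w.
Proof. by rewrite /dot mulNmx mxE. Qed.

Lemma dotZl (R : realType) n a (u w : 'rV[R]_n) : dot (a *: u) w = a * dot u w.
Proof. by rewrite /dot -scalemxAl mxE. Qed.

Lemma dotDr (R : realType) n (u v w : 'rV[R]_n) :
  dot w (u + v) = dot w u + dot w v.
Proof. by rewrite dotC dotDl !(dotC _ w). Qed.

Lemma dotNr (R : realType) n (u w : 'rV[R]_n) : dot w (- u) = - dot w u.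
Proof. by rewrite dotC dotNl dotC. Qed.

Lemma dotZr (R : realType) n a (u w : 'rV[R]_n) : dot w (a *: u) = a * dot w u.
Proof. by rewrite dotC dotZl dotC. Qed.

Definition dotlin := (dotDl, dotDr, dotNl, dotNr, dotZl, dotZr).

Lemma dotvv_ge0 (R : realType) n (u : 'rV[R]_n) : 0 <= dot u u.
Proof. by rewrite dotE; apply: sumr_ge0 => i _; rewrite -expr2 sqr_ge0. Qed.

Lemma dotvv_eq0 (R : realType) n (u : 'rV[R]_n) : dot u u = 0 -> u = 0.
Proof.
rewrite dotE => /eqP; rewrite psumr_eq0; last first.
  by move=> i _; rewrite -expr2 sqr_ge0.
move=> /allP u0; apply/rowP => i; rewrite mxE.
by have := u0 i (mem_index_enum _); rewrite /= mulf_eq0 orbb => /eqP.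
Qed.

Lemma sqr_enorm (R : realType) n (u : 'rV[R]_n) : enorm u ^+ 2 = dot u u.
Proof. by rewrite /enorm sqr_sqrtr // dotvv_ge0. Qed.

Lemma enorm_ge0 (R : realType) n (u : 'rV[R]_n) : 0 <= enorm u.
Proof. exact: sqrtr_ge0. Qed.

Lemma enorm0 (R : realType) n : enorm (0 : 'rV[R]_n) = 0.
Proof. by rewrite /enorm /dot mul0mx mxE sqrtr0. Qed.

Lemma enormZ (R : realType) n a (u : 'rV[R]_n) :
  enorm (a *: u) = `|a| * enorm u.
Proof.
by rewrite /enorm !dotlin mulrA -expr2 sqrtrM ?sqr_ge0 // sqrtr_sqr.
Qed.

Lemma enormN (R : realType) n (u : 'rV[R]_n) : enorm (- u) = enorm u.
Proof. by rewrite /enorm !dotlin opprK. Qed.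

Lemma enormC (R : realType) n (u v : 'rV[R]_n) : enorm (u - v) = enorm (v - u).
Proof. by rewrite -enormN opprB. Qed.

Lemma dot_le_enorm (R : realType) n (u v : 'rV[R]_n) :
  dot u v <= enorm u * enorm v.
Proof.
have [/eqP|vn0] := boolP (enorm v == 0).
  move=> v0; have : dot v v = 0 by rewrite -sqr_enorm v0 expr0n.
  by move=> /dotvv_eq0 ->; rewrite enorm0 mulr0 dotC /dot mul0mx mxE.
have v_gt0 : 0 < enorm v by rewrite lt_def vn0 enorm_ge0.
have u0 := enorm_ge0 u.
(* The discriminant inequality, from the square of |v| u - |u| v. *)
have := dotvv_ge0 (enorm v *: u - enorm u *: v).
rewrite !dotlin -!sqr_enorm (dotC v u) => H.
have [/eqP uz|un0] := boolP (enorm u == 0).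
  have : dot u u = 0 by rewrite -sqr_enorm uz expr0n.
  by move=> /dotvv_eq0 ->; rewrite enorm0 mul0r /dot mul0mx mxE.
have u_gt0 : 0 < enorm u by rewrite lt_def un0 enorm_ge0.
have uv_gt0 := mulr_gt0 u_gt0 v_gt0.
rewrite -(ler_pM2l uv_gt0) -subr_ge0.
by nra.
Qed.

Lemma ler_enormD (R : realType) n (u v : 'rV[R]_n) :
  enorm (u + v) <= enorm u + enorm v.
Proof.
rewrite -(@ler_pXn2r _ 2) ?nnegrE ?addr_ge0 ?enorm_ge0 //.
rewrite sqr_enorm !dotlin -!sqr_enorm (dotC v u).
by have := dot_le_enorm u v; nra.
Qed.

Lemma enorm_convex (R : realType) n (s : R) (u v w : 'rV[R]_n) :
  enorm (s *: u + (1 - s) *: v - w) ^+ 2 =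
  s * enorm (u - w) ^+ 2 + (1 - s) * enorm (v - w) ^+ 2
  - s * (1 - s) * enorm (u - v) ^+ 2.
Proof.
by rewrite !sqr_enorm !dotlin (dotC v u) (dotC w u) (dotC w v); ring.
Qed.

(** The library norm on row vectors is the sup norm; enorm is at most the square
    root of n times it. *)
Lemma compact_enorm_bounded (R : realType) n (U : set 'rV[R]_n) :
  compact U -> exists2 D : R, 0 < D &
    forall u v, U u -> U v -> enorm (u - v) <= D.
Proof.
move=> /compact_bounded [M [_ /(_ (`|M| + 1)) /=]].
rewrite (le_lt_trans (ler_norm M)) ?ltrDl // => /(_ isT) HM.
set B := `|M| + 1 in HM *.
have B0 : 0 < B by rewrite ltr_wpDl.
have bnd u : U u -> enorm u <= Num.sqrt (n%:R * B ^+ 2).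
  move=> /HM uB; apply: ler_wsqrtr; rewrite dotE.
  rewrite mulr_natl -[in leRHS](card_ord n) -sumr_const; apply: ler_sum => i _.
  rewrite -expr2 -real_normK ?num_real // ler_pXn2r ?nnegrE ?normr_ge0 ?(ltW B0) //.
  apply: le_trans uB; rewrite /Num.Def.normr /= mx_normrE.
  exact: (le_bigmax _ (fun i : 'I_1 * 'I_n => `|u i.1 i.2|) (0, i)).
exists (2 * Num.sqrt (n%:R * B ^+ 2) + 1).
  by rewrite ltr_wpDl // mulr_ge0 // sqrtr_ge0.
move=> u v /bnd Hu /bnd Hv.
by have := ler_enormD u (- v); rewrite enormN; lra.
Qed.

(** * Lipschitz gradients and strong concavity *)

Lemma differentiable_grad (R : realType) n (F : 'rV[R]_n -> R) p v :
  differentiable F p -> is_derive p v F (dot (grad F p) v).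
Proof.
move=> dF; apply: DeriveDef; first exact: diff_derivable.
rewrite deriveE // {1}(row_sum_delta v) linear_sum dotE.
by apply: eq_bigr => i _; rewrite linearZ /= mxE deriveE // mulrC.
Qed.

Lemma is_derive_grad (R : realType) n (F : 'rV[R]_n -> R) p w :
  (forall v, is_derive p v F (dot w v)) -> grad F p = w.
Proof.
move=> dF; apply/rowP => i; rewrite mxE derive_val dotE (bigD1 i) //=.
rewrite mxE !eqxx mulr1 big1 ?addr0 // => j ji.
by rewrite mxE eqxx /= (negbTE ji) mulr0.
Qed.

(** The gradient map is a parameter, so that the gradient of the regularized payoff
    can enter in closed form. *)
Definition lipschitz_gradient (R : realType) n (U : set 'rV[R]_n)
    (F : 'rV[R]_n -> R) (G : 'rV[R]_n -> 'rV[R]_n) (M : R) : Prop :=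
  (forall p v, U p -> is_derive p v F (dot (G p) v)) /\
  (forall p q, U p -> U q -> enorm (G p - G q) <= M * enorm (p - q)).

Lemma convex_setP (R : realType) n (U : set 'rV[R]_n) :
  convex_set U -> forall (s : R) u v, 0 <= s <= 1 -> U u -> U v ->
  U (s *: u + (1 - s) *: v).
Proof.
move=> cU s u v s01 Uu Uv.
have := cU u v (Itv01 (andP s01).1 (andP s01).2) (mem_set Uu) (mem_set Uv).
by move/set_mem.
Qed.

Lemma is_derive_line (R : realType) n (F : 'rV[R]_n -> R) (p v : 'rV[R]_n)
    (s d : R) :
  is_derive (p + s *: v) v F d ->
  is_derive s 1 (fun t : R => F (p + t *: v)) d.
Proof.
move=> [dF Fd].
have E : (fun h : R => h^-1 *: (((fun t : R => F (p + t *: v)) \o shift s) (h *: 1)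
    - F (p + s *: v))) =
  (fun h : R => h^-1 *: ((F \o shift (p + s *: v)) (h *: v) - F (p + s *: v))).
  apply/funext => h /=; congr (_ *: (F _ - _)).
  by apply/rowP => i; rewrite !mxE [_ *: 1]mulr1; ring.
by apply: DeriveDef; [rewrite /derivable E|rewrite -Fd /derive E].
Qed.

(** The descent lemma: along the segment from p to q the derivative moves by at
    most M s |q - p|^2, so plus or minus the difference of F and its linear model,
    with M/2 s^2 |q - p|^2 added, is nondecreasing in s. *)
Lemma descent (R : realType) n (U : set 'rV[R]_n) F G (M : R) :
  convex_set U -> lipschitz_gradient U F G M ->
  forall p q, U p -> U q ->
  `|F q - F p - dot (G p) (q - p)| <= M / 2 * enorm (q - p) ^+ 2.
Proof.
move=> cU [dF lG] p q Up Uq.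
set v := q - p; set N := enorm v ^+ 2.
have Useg s : 0 <= s <= 1 -> U (p + s *: v).
  move=> s01; have -> : p + s *: v = s *: q + (1 - s) *: p.
    by apply/rowP => i; rewrite !mxE; ring.
  exact: convex_setP.
have dev s : 0 <= s <= 1 -> `|dot (G (p + s *: v)) v - dot (G p) v| <= M * s * N.
  move=> s01; have /andP[s0 s1] := s01.
  have := lG _ _ (Useg _ s01) Up.
  rewrite addrAC subrr add0r enormZ (ger0_norm s0) => H.
  have v0 := enorm_ge0 v.
  have C1 := dot_le_enorm (G (p + s *: v) - G p) v.
  have C2 := dot_le_enorm (- (G (p + s *: v) - G p)) v.
  move: C1 C2; rewrite enormN !dotlin => C1 C2.
  rewrite ler_norml /N expr2; apply/andP; split; nra.
have mono (e : R) : e ^+ 2 = 1 ->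
    0 <= e * (F q - F p - dot (G p) v) + M / 2 * N.
  move=> e2.
  pose psi (t : R) := e * (F (p + t *: v) - t * dot (G p) v) + M / 2 * N * t ^+ 2.
  pose dpsi (t : R) := e * (dot (G (p + t *: v)) v - dot (G p) v) + M * N * t.
  have Dpsi (t : R) : 0 <= t <= 1 -> is_derive t 1 psi (dpsi t).
    move=> t01; have dt := is_derive_line (dF _ v (Useg _ t01)).
    rewrite /psi /dpsi; apply: is_derive_eq.
    by move: (dot (G _) _) => d; rewrite /GRing.scale /= !mulr1; field.
  have [c c01 E] : exists2 c, c \in `[0, 1] & psi 1 - psi 0 = dpsi c * (1 - 0).
    apply: MVT_segment => //.
      by move=> t /[!in_itv] /= /andP[t0 t1]; apply: Dpsi; rewrite !ltW.
    apply: derivable_within_continuous => t /[!in_itv] /= t01.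
    by have [] := Dpsi t t01.
  have : psi 1 - psi 0 = e * (F q - F p - dot (G p) v) + M / 2 * N.
    have -> : q = p + 1 *: v by apply/rowP => i; rewrite !mxE; ring.
    by rewrite /psi scale0r addr0; ring.
  rewrite E subr0 mulr1 => <-.
  move: c01; rewrite in_itv /= => /dev /ler_normlP [d1 d2].
  have /eqP : (e - 1) * (e + 1) = 0 by transitivity (e ^+ 2 - 1); [ring|rewrite e2 subrr].
  rewrite mulf_eq0 subr_eq0 addr_eq0 => /orP[]/eqP ee; rewrite /dpsi ee; lra.
have h1 := mono 1 (expr1n _ _).
have h2 := mono (- 1) (etrans (sqrrN 1) (expr1n _ _)).
by rewrite ler_norml; apply/andP; split; lra.
Qed.

(** Stands in for the limit s -> 0 in inequalities that are affine in s. *)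
Lemma le_of_scaled_le (R : realType) (a b c : R) :
  (forall s, 0 < s -> s <= 1 -> a <= b + s * c) -> a <= b.
Proof.
move=> H; rewrite leNgt; apply/negP => ba.
have H1 := H 1 ltr01 (lexx _).
have c0 : 0 < c by lra.
have s0 : 0 < (a - b) / (2 * c) by rewrite divr_gt0 //; lra.
have [s1|/ltW s1] := leP ((a - b) / (2 * c)) 1.
  have := H _ s0 s1.
  have -> : (a - b) / (2 * c) * c = (a - b) / 2 by field; lra.
  lra.
move: s1; rewrite ler_pdivlMr; lra.
Qed.

(** Divide the concavity inequality between p and a nearby point of the segment
    by the small weight s. The descent lemma plays the part of the limit s -> 0. *)
Lemma strongly_concave_le_tangent (R : realType) n (U : set 'rV[R]_n) F G (M m : R) :
  convex_set U -> lipschitz_gradient U F G M -> strongly_concave m U F ->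
  forall p q, U p -> U q ->
  F q <= F p + dot (G p) (q - p) - m / 2 * enorm (q - p) ^+ 2.
Proof.
move=> cU sF cF p q Up Uq; set N := enorm (q - p) ^+ 2.
apply: (@le_of_scaled_le _ _ _ ((M + m) / 2 * N)) => s s0 s1.
have s01 : 0 <= s <= 1 by rewrite ltW.
have := cF q p s Uq Up s01; rewrite -/N.
have := descent cU sF Up (convex_setP cU s01 Uq Up).
have -> : s *: q + (1 - s) *: p - p = s *: (q - p).
  by apply/rowP => i; rewrite !mxE; ring.
rewrite enormZ exprMn real_normK ?num_real // -/N dotZr ler_norml => /andP[_ D] C.
rewrite -(ler_pM2l s0); nra.
Qed.

(** Quadratic growth away from a maximizer, by comparison with the points of the
    segment that approach it. *)
Lemma strongly_concave_max (R : realType) n (U : set 'rV[R]_n) F (m : R) p :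
  convex_set U -> strongly_concave m U F -> U p ->
  (forall q, U q -> F q <= F p) ->
  forall q, U q -> F q <= F p - m / 2 * enorm (q - p) ^+ 2.
Proof.
move=> cU cF Up maxp q Uq; set N := enorm (q - p) ^+ 2.
apply: (@le_of_scaled_le _ _ _ (m / 2 * N)) => s s0 s1.
have s01 : 0 <= s <= 1 by rewrite ltW.
have := cF q p s Uq Up s01; have := maxp _ (convex_setP cU s01 Uq Up).
rewrite -/N => D C; rewrite -(ler_pM2l s0); nra.
Qed.

(** For m positive and M zero this leaves a single point in U, which settles the
    degenerate step size in projected_gradient_contraction. *)
Lemma strong_concavity_le_lipschitz (R : realType) n (U : set 'rV[R]_n) F G (M m : R) :
  convex_set U -> lipschitz_gradient U F G M -> strongly_concave m U F ->
  forall p q, U p -> U q -> m * enorm (q - p) ^+ 2 <= M * enorm (q - p) ^+ 2.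
Proof.
move=> cU sF cF p q Up Uq.
have A := strongly_concave_le_tangent cU sF cF Up Uq.
have B := strongly_concave_le_tangent cU sF cF Uq Up.
have C := dot_le_enorm (G p - G q) (q - p).
have := sF.2 p q Up Uq; rewrite (enormC p q) => D.
have E := enorm_ge0 (q - p).
move: B; rewrite (enormC p q) -(opprB q p) dotNr => B.
move: C; rewrite dotDl dotNl => C.
by have := ler_wpM2r E D; rewrite -mulrA -expr2; lra.
Qed.

Lemma strongly_concaveW (R : realType) n (U : set 'rV[R]_n) F (m m' : R) :
  m' <= m -> strongly_concave m U F -> strongly_concave m' U F.
Proof.
move=> mm cF u v s Uu Uv s01; apply: le_trans (cF u v s Uu Uv s01).
rewrite lerD2l; have /andP[s0 s1] := s01; have s2 : 0 <= 1 - s by lra.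
rewrite !ler_wpM2r ?sqr_ge0 //; lra.
Qed.

(** * One projected gradient step *)

(** The new point maximizes over U the quadratic lower model of F at y, so it does
    at least as well as the point at fraction s from y to z. At that point the
    linear term gains s (F z - F y) plus s m/2 |z - y|^2 by strong concavity, and
    s M <= m lets the latter pay for the quadratic term of the model. *)
Lemma projected_gradient_contraction (R : realType) n (U : set 'rV[R]_n) F G
    (M m s : R) (y z y' : 'rV[R]_n) :
  convex_set U -> lipschitz_gradient U F G M -> strongly_concave m U F ->
  0 <= M -> 0 < m -> 0 <= s <= 1 -> s * M <= m -> U y -> U z ->
  PO U (y + M^-1 *: G y) y' ->
  F z - F y' <= (1 - s) * (F z - F y).
Proof.
move=> cU sF cF M0 m0 s01 sM Uy Uz [Uy' proj].
have /andP[s0 s1] := s01.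
move: M0; rewrite le_eqVlt => /orP[/eqP M0|M0].
  (* A constant gradient leaves a single point in U, a fixed point of the step. *)
  have U1 p : U p -> p = y.
    move=> Up; have := strong_concavity_le_lipschitz cU sF cF Uy Up.
    rewrite -M0 mul0r pmulr_rle0 // sqr_enorm => p0.
    by apply/eqP; rewrite -subr_eq0; apply/eqP/dotvv_eq0/le_anti;
      rewrite p0 dotvv_ge0.
  by rewrite (U1 _ Uz) (U1 _ Uy') subrr mulr0.
set w := s *: z + (1 - s) *: y.
have Uw : U w by exact: convex_setP.
have Ew : w - y = s *: (z - y) by apply/rowP => i; rewrite !mxE; ring.
(* The projection maximizes the quadratic lower model of F at y. *)
have model : dot (G y) (w - y) - M / 2 * enorm (w - y) ^+ 2 <=
    dot (G y) (y' - y) - M / 2 * enorm (y' - y) ^+ 2.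
  have E p : enorm (y + M^-1 *: G y - p) ^+ 2 = enorm (p - y) ^+ 2 -
      2 * M^-1 * dot (G y) (p - y) + M^-1 ^+ 2 * dot (G y) (G y).
    have -> : y + M^-1 *: G y - p = M^-1 *: G y - (p - y).
      by apply/rowP => i; rewrite !mxE; ring.
    move: (p - y) => d; rewrite !sqr_enorm !dotlin (dotC d (G y)); ring.
  have := proj _ Uw; rewrite !E lerD2r => H.
  have : M / 2 * (enorm (y' - y) ^+ 2 - 2 * M^-1 * dot (G y) (y' - y)) <=
         M / 2 * (enorm (w - y) ^+ 2 - 2 * M^-1 * dot (G y) (w - y)).
    by rewrite ler_wpM2l // divr_ge0 // ltW.
  have K p : M / 2 * (enorm (p - y) ^+ 2 - 2 * M^-1 * dot (G y) (p - y)) =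
     M / 2 * enorm (p - y) ^+ 2 - dot (G y) (p - y) by field; lra.
  by rewrite !K; lra.
have := descent cU sF Uy Uy'; rewrite ler_norml => /andP[low _].
have := strongly_concave_le_tangent cU sF cF Uy Uz.
move: model; rewrite Ew dotZr enormZ exprMn real_normK ?num_real //.
have := sqr_ge0 (enorm (z - y)); set N := enorm (z - y) ^+ 2.
move=> N0 model tan.
have := ler_wpM2l s0 tan.
have : s * (s * M) * N <= s * m * N.
  by rewrite ler_wpM2r // ler_wpM2l.
move: low model; set a := dot (G y) (y' - y); set b := dot (G y) (z - y).
by set c := enorm (y' - y) ^+ 2; lra.
Qed.

(** * Quadratic regularization *)

(** Along a line the squared distance is a polynomial of degree two. *)
Lemma is_derive_sqr_enorm (R : realType) n (y0 p v : 'rV[R]_n) :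
  is_derive p v (fun y => enorm (y - y0) ^+ 2) (2 * dot (p - y0) v).
Proof.
pose q (h : R) := enorm (p - y0) ^+ 2 + h * (2 * dot (p - y0) v)
  + h ^+ 2 * enorm v ^+ 2.
have Eq : (fun h : R => enorm (h *: v + p - y0) ^+ 2) = q.
  apply/funext => h; rewrite /q !sqr_enorm !dotlin (dotC v p) (dotC v y0).
  by rewrite (dotC y0 p); ring.
have dq : is_derive (0 : R) 1 q (2 * dot (p - y0) v).
  rewrite /q; apply: is_derive_eq.
  by rewrite /GRing.scale /= !(mulr0, mul0r, addr0, add0r, mulr1, mul1r).
apply: DeriveDef.
  by apply/derivable1P; rewrite Eq; case: dq.
rewrite -(@derive_val _ _ _ _ _ _ _ dq) /derive.
have -> // : (fun h : R => h^-1 *: ((q \o shift 0) (h *: 1) - q 0)) =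
  (fun h : R => h^-1 *: (((fun y => enorm (y - y0) ^+ 2) \o shift p) (h *: v)
    - enorm (p - y0) ^+ 2)).
by apply/funext => h; rewrite -Eq /= addr0 [_ *: 1]mulr1 scale0r add0r.
Qed.

Section Regularization.
Context {R : realType} {n : nat} (U : set 'rV[R]_n) (F : 'rV[R]_n -> R)
  (y0 : 'rV[R]_n) (b : R).
Let F_reg (y : 'rV[R]_n) := F y - b / 2 * enorm (y - y0) ^+ 2.

Lemma regularized_lipschitz_gradient G M :
  0 <= b -> lipschitz_gradient U F G M ->
  lipschitz_gradient U F_reg (fun y => G y - b *: (y - y0)) (M + b).
Proof.
move=> b0 [dF lG]; split=> [p v Up|p q Up Uq].
  have dp := dF p v Up; have dq := is_derive_sqr_enorm y0 p v.
  rewrite /F_reg; apply: is_derive_eq.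
  have -> : dot (G p - b *: (p - y0)) v = dot (G p) v - b * dot (p - y0) v.
    by rewrite dotDl dotNl dotZl.
  move: (dot (p - y0) v) => d; move: (dot _ _) => e.
  by rewrite /GRing.scale /= ?(scaler0, mulr0, addr0); field.
have -> : G p - b *: (p - y0) - (G q - b *: (q - y0)) =
    (G p - G q) + - (b *: (p - q)) by apply/rowP => i; rewrite !mxE; ring.
apply: le_trans (ler_enormD _ _) _.
by rewrite enormN enormZ (ger0_norm b0) mulrDl lerD2r; exact: lG.
Qed.

Lemma regularized_strongly_concave m :
  strongly_concave m U F -> strongly_concave (m + b) U F_reg.
Proof.
move=> cF u v s Uu Uv s01; rewrite /F_reg enorm_convex.
by have := cF u v s Uu Uv s01; lra.
Qed.

End Regularization.

(** * The payoff and its regularized primal function *)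

Definition reg_primal (R : realType) dx dy (Y : set 'rV[R]_dy)
    (L : 'rV[R]_dx -> 'rV[R]_dy -> R) (y0 : 'rV[R]_dy) (b : R)
    (x : 'rV[R]_dx) : R :=
  sup [set regularized L y0 b x u | u in Y].

Lemma regularized0 (R : realType) dx dy (L : 'rV[R]_dx -> 'rV[R]_dy -> R) y0 x y :
  regularized L y0 0 x y = L x y.
Proof. by rewrite /regularized !mul0r subr0. Qed.

Lemma reg_primal0 (R : realType) dx dy (Y : set 'rV[R]_dy)
    (L : 'rV[R]_dx -> 'rV[R]_dy -> R) y0 :
  reg_primal Y L y0 0 = primal Y L.
Proof.
apply/funext => x; congr sup; apply/seteqP.
by split=> _ [u Yu <-]; exists u; rewrite ?regularized0.
Qed.

Lemma continuous_sqr_enorm (R : realType) n (y0 : 'rV[R]_n) :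
  continuous (fun y : 'rV[R]_n => enorm (y - y0) ^+ 2).
Proof.
have -> : (fun y : 'rV[R]_n => enorm (y - y0) ^+ 2) =
    (fun y : 'rV[R]_n => \sum_(i < n) (y 0 i - y0 0 i) * (y 0 i - y0 0 i)).
  apply/funext => y; rewrite sqr_enorm dotE.
  by apply: eq_bigr => i _; rewrite !mxE.
apply: continuous_big => [|i _ y]; first exact: add_continuous.
have c : {for y, continuous (fun y : 'rV[R]_n => y 0 i - y0 0 i)}.
  apply: (@continuousB _ _ _ (fun y : 'rV[R]_n => y 0 i) (fun=> y0 0 i)).
    exact: coord_continuous.
  exact: cst_continuous.
exact: (continuousM c c).
Qed.

Section Payoff.
Context {R : realType} {dx dy : nat} {X : set 'rV[R]_dx} {Y : set 'rV[R]_dy}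
  {L : 'rV[R]_dx -> 'rV[R]_dy -> R} {mu Lxx Lyy Lyx : R}
  (HS : standing_assumption X Y L mu Lxx Lyy Lyx)
  (HX : forall y, Y y -> convex_function X (fun x => L x y)).

Let cX := X_convex HS.
Let cY := Y_convex HS.

Lemma payoff_differentiable x y : X x -> Y y ->
  differentiable (fun x' => L x' y) x /\ differentiable (L x) y.
Proof.
move=> Xx Yy; have [U [_ UXY /(_ (x, y)) UC1]] := L_C1 HS.
have [dL _] := UC1 (UXY (x, y) (conj Xx Yy)).
split.
- apply: (@differentiable_comp _ _ _ _ (fun x' => (x', y)) (fun z => L z.1 z.2)).
    exact: differentiable_pair.
  exact: dL.
- apply: (@differentiable_comp _ _ _ _ (fun y' => (x, y')) (fun z => L z.1 z.2)).
    exact: differentiable_pair.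
  exact: dL.
Qed.

Lemma payoff_lipschitz_grad_x y : Y y ->
  lipschitz_gradient X (fun x => L x y) (fun x => grad_x L x y) Lxx.
Proof.
move=> Yy; split=> [p v Xp|p q Xp Xq].
  exact: differentiable_grad (payoff_differentiable Xp Yy).1.
have := grad_x_lipschitz HS Xp Xq Yy Yy.
by rewrite subrr enorm0 mulr0 addr0.
Qed.

Lemma payoff_lipschitz_grad_y x : X x -> lipschitz_gradient Y (L x) (grad_y L x) Lyy.
Proof.
move=> Xx; split=> [p v Yp|p q Yp Yq].
  exact: differentiable_grad (payoff_differentiable Xx Yp).2.
have := grad_y_lipschitz HS Xx Xx Yp Yq.
by rewrite subrr enorm0 mulr0 add0r.
Qed.

Lemma payoff_ge_tangent y x x' : Y y -> X x -> X x' ->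
  L x y + dot (grad_x L x y) (x' - x) <= L x' y.
Proof.
move=> Yy Xx Xx'; have [dL lL] := payoff_lipschitz_grad_x Yy.
have sL : lipschitz_gradient X (fun x => - L x y) (fun x => - grad_x L x y) Lxx.
  split=> [p v Xp|p q Xp Xq].
    by have dp := dL p v Xp; rewrite dotNl; exact: is_deriveN.
  by rewrite -opprD enormN; exact: lL.
have cL : strongly_concave 0 X (fun x => - L x y).
  move=> u v s Xu Xv s01.
  have convL : L (s *: u + (1 - s) *: v) y <= s * L u y + (1 - s) * L v y :=
    HX Yy (Itv01 (andP s01).1 (andP s01).2) (mem_set Xu) (mem_set Xv).
  by rewrite !mul0r addr0 !mulrN -opprD lerN2.
have := strongly_concave_le_tangent cX sL cL Xx Xx'.
by rewrite dotNl; lra.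
Qed.

Lemma payoff_le_model y x x' : Y y -> X x -> X x' ->
  L x' y <= L x y + dot (grad_x L x y) (x' - x) + Lxx / 2 * enorm (x' - x) ^+ 2.
Proof.
move=> Yy Xx Xx'.
have := descent cX (payoff_lipschitz_grad_x Yy) Xx Xx'.
by rewrite ler_norml => /andP[_]; lra.
Qed.

(** The cost of evaluating the gradient in x at the wrong dual point. *)
Lemma payoff_cross x y y' v : X x -> Y y -> Y y' ->
  dot (grad_x L x y') v <= dot (grad_x L x y) v + Lyx * enorm (y' - y) * enorm v.
Proof.
move=> Xx Yy Yy'; have := dot_le_enorm (grad_x L x y' - grad_x L x y) v.
have := grad_x_lipschitz HS Xx Xx Yy' Yy; rewrite subrr enorm0 mulr0 add0r => H.
by have := ler_wpM2r (enorm_ge0 v) H; rewrite dotDl dotNl; lra.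
Qed.

Section Fixed_center.
Context (y0 : 'rV[R]_dy).
Let Lreg := regularized L y0.
Let P := reg_primal Y L y0.

Lemma regularized_payoff_lipschitz b x : 0 <= b -> X x ->
  lipschitz_gradient Y (Lreg b x) (fun y => grad_y L x y - b *: (y - y0)) (Lyy + b).
Proof.
by move=> b0 Xx; apply: regularized_lipschitz_gradient (payoff_lipschitz_grad_y Xx).
Qed.

Lemma regularized_payoff_strongly_concave b x : X x ->
  strongly_concave (mu + b) Y (Lreg b x).
Proof.
by move=> Xx; apply: regularized_strongly_concave (L_strongly_concave HS Xx).
Qed.

Lemma reg_primal_max b x : 0 <= b -> X x ->
  exists u, [/\ Y u, P b x = Lreg b x u & forall w, Y w -> Lreg b x w <= P b x].
Proof.
move=> b0 Xx; have [dL _] := regularized_payoff_lipschitz b0 Xx.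
have contL : {within Y, continuous (Lreg b x)}.
  apply: continuous_in_subspaceT => y /set_mem Yy.
  apply: (@continuousB _ _ _ (L x) (fun y => b / 2 * enorm (y - y0) ^+ 2)).
    exact/differentiable_continuous/(payoff_differentiable Xx Yy).2.
  apply: (@continuousM _ _ (fun=> b / 2)); first exact: cst_continuous.
  exact: continuous_sqr_enorm.
have [u /set_mem Yu maxu] := EVT_max_rV (Y_nonempty HS) (Y_compact HS) contL.
have {}maxu w : Y w -> Lreg b x w <= Lreg b x u by move=> Yw; apply/maxu/mem_set.
have PE : P b x = Lreg b x u.
  apply/eqP; rewrite eq_le; apply/andP; split.
    apply: ge_sup; first by exists (Lreg b x u), u.
    by move=> _ [w Yw <-]; exact: maxu.
  apply: ub_le_sup; last by exists u.
  by exists (Lreg b x u) => _ [w Yw <-]; exact: maxu.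
by exists u; rewrite PE.
Qed.

(** Danskin's formula is replaced by evaluating the payoff at the new maximizer
    u': quadratic growth at the old maximizer u pays for the displacement of u',
    and the distance of y to u is paid for by the dual gap of y, in a proportion
    r that is free. *)
Lemma reg_primal_le_model b m r x x' y :
  0 <= b -> 0 < m -> m <= mu + b -> 0 < r -> X x -> X x' -> Y y ->
  P b x' <= P b x + dot (grad_x L x y) (x' - x) + r * (P b x - Lreg b x y)
    + (Lxx / 2 + Lyx ^+ 2 / (2 * m) + Lyx ^+ 2 / (2 * m * r))
      * enorm (x' - x) ^+ 2.
Proof.
move=> b0 m0 mb r0 Xx Xx' Yy.
have [u [Yu Pu maxu]] := reg_primal_max b0 Xx.
have [u' [Yu' Pu' _]] := reg_primal_max b0 Xx'.
have growth w : Y w -> Lreg b x w <= P b x - m / 2 * enorm (w - u) ^+ 2.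
  move=> Yw; rewrite Pu; apply: strongly_concave_max Yw => //.
    exact: strongly_concaveW mb (regularized_payoff_strongly_concave _ Xx).
  by move=> q Yq; rewrite -Pu; exact: maxu.
have G1 := growth u' Yu'; have G2 := growth y Yy.
have Lyx0 := Lyx_gt0 HS.
have M := payoff_le_model Yu' Xx Xx'.
have C := payoff_cross (x' - x) Xx Yy Yu'.
have T : enorm (u' - y) <= enorm (u' - u) + enorm (y - u).
  rewrite (enormC y); have -> : u' - y = (u' - u) + (u - y).
    by apply/rowP => i; rewrite !mxE; ring.
  exact: ler_enormD.
have D0 := enorm_ge0 (x' - x).
move: T C M G1 G2; rewrite Pu' /Lreg /regularized -/(Lreg b x y).
set D := enorm (x' - x) in D0 *; set e' := enorm (u' - u); set e := enorm (y - u).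
move=> T C M G1 G2.
have T' : Lyx * enorm (u' - y) * D <= Lyx * (e' + e) * D.
  by rewrite ler_wpM2r // ler_wpM2l // ltW.
(* Young's inequality, with weights m and m r. *)
have young k d : 0 < k -> Lyx * d * D <= k / 2 * d ^+ 2 + Lyx ^+ 2 / (2 * k) * D ^+ 2.
  move=> k0; rewrite -subr_ge0.
  have -> : k / 2 * d ^+ 2 + Lyx ^+ 2 / (2 * k) * D ^+ 2 - Lyx * d * D =
      (k * d - Lyx * D) ^+ 2 / (2 * k) by field; lra.
  by rewrite divr_ge0 ?sqr_ge0 // mulr_ge0 // ltW.
have Y1 := young m e' m0.
have Y2 := young (m * r) e (mulr_gt0 m0 r0).
have -> : 2 * m * r = 2 * (m * r) by ring.
have := ler_wpM2l (ltW r0) G2.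
by rewrite -/(Lreg b x y); lra.
Qed.

Lemma reg_primal_antitone b b' D x : (forall u v, Y u -> Y v -> enorm (u - v) <= D) ->
  Y y0 -> 0 <= b' -> b' <= b -> X x ->
  P b' x <= P b x + (b - b') / 2 * D ^+ 2.
Proof.
move=> HD Yy0 b'0 bb Xx.
have [u' [Yu' Pu' _]] := reg_primal_max b'0 Xx.
have [u [_ _ /(_ u' Yu')]] := reg_primal_max (le_trans b'0 bb) Xx.
have e0 := enorm_ge0 (u' - y0).
have : enorm (u' - y0) ^+ 2 <= D ^+ 2.
  by rewrite ler_pXn2r ?nnegrE // ?HD //; apply: le_trans e0 (HD _ _ Yu' Yy0).
have c0 : 0 <= (b - b') / 2 by lra.
move=> /(ler_wpM2l c0); rewrite Pu' /Lreg /regularized; lra.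
Qed.

End Fixed_center.

Lemma payoff_le_primal x y : X x -> Y y -> L x y <= primal Y L x.
Proof.
move=> Xx Yy; rewrite -(reg_primal0 _ _ 0) -(regularized0 _ 0).
by have [u [_ _ ]] := reg_primal_max 0 (lexx 0) Xx; exact.
Qed.

End Payoff.

(** * One iteration of the algorithm *)

Section Run.
Context {R : realType} {dx dy : nat} {X : set 'rV[R]_dx} {Y : set 'rV[R]_dy}
  {L : 'rV[R]_dx -> 'rV[R]_dy -> R} {mu Lxx Lyy Lyx : R}
  (HS : standing_assumption X Y L mu Lxx Lyy Lyx)
  (HX : forall y, Y y -> convex_function X (fun x => L x y))
  {tau beta m s : nat -> R} {x : nat -> 'rV[R]_dx} {y : nat -> 'rV[R]_dy}
  (Hrun : lmo_po_run X Y L Lyy tau beta x y)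
  (tau_gt0 : forall t, 0 < tau t) (tau_le1 : forall t, tau t <= 1)
  (beta_ge0 : forall t, 0 <= beta t)
  (beta_antitone : forall t, beta t.+1 <= beta t)
  (m_gt0 : forall t, 0 < m t) (m_le : forall t, m t <= mu + beta t)
  (s_gt0 : forall t, 0 < s t) (s_le1 : forall t, s t <= 1)
  (s_le : forall t, s t * (Lyy + beta t) <= m t)
  {D : R}
  (XD : forall u v, X u -> X v -> enorm (u - v) <= D)
  (YD : forall u v, Y u -> Y v -> enorm (u - v) <= D).

(* Above, m t is a modulus of strong concavity of the regularized payoff at time t,
   and s t the fraction by which the dual step contracts the gap. *)
Definition primal_seq t := reg_primal Y L (y 0%N) (beta t) (x t).
Definition dual_gap_seq t :=
  primal_seq t - regularized L (y 0%N) (beta t) (x t) (y t).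

Lemma run_in_domain t : X (x t) /\ Y (y t).
Proof.
have [X0 Y0 step] := Hrun.
elim: t => [//|t [Xt Yt]].
have [[v [Xv _] ->] [Yt' _]] := step t.
split=> //; have -> : x t + tau t *: (v - x t) = tau t *: v + (1 - tau t) *: x t.
  by apply/rowP => i; rewrite !mxE; ring.
by apply: (convex_setP (X_convex HS)) => //; rewrite ltW ?tau_le1.
Qed.

Lemma run_displacement t : enorm (x t.+1 - x t) ^+ 2 <= tau t ^+ 2 * D ^+ 2.
Proof.
have [_ _ step] := Hrun; have [[v [Xv _] ->] _] := step t.
rewrite addrAC subrr add0r enormZ exprMn real_normK ?num_real //.
have Xt := (run_in_domain t).1; have e0 := enorm_ge0 (v - x t).
rewrite ler_wpM2l ?sqr_ge0 // ler_pXn2r ?nnegrE ?XD //.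
by apply: le_trans e0 (XD _ _).
Qed.

Lemma dual_gap_seq_ge0 t : 0 <= dual_gap_seq t.
Proof.
have [Xt Yt] := run_in_domain t.
have [u [_ _ /(_ _ Yt)]] := reg_primal_max HS (y 0%N) (beta_ge0 t) Xt.
by rewrite subr_ge0.
Qed.

Lemma dual_gap_seq_half_step t :
  primal_seq t - regularized L (y 0%N) (beta t) (x t) (y t.+1)
    <= (1 - s t) * dual_gap_seq t.
Proof.
have [Xt Yt] := run_in_domain t; have [_ _ step] := Hrun; have [_ PO_t] := step t.
have sL := regularized_payoff_lipschitz HS (y 0%N) (beta_ge0 t) Xt.
rewrite (is_derive_grad (fun v => sL.1 _ v Yt)) in PO_t.
have [u [Yu Pu _]] := reg_primal_max HS (y 0%N) (beta_ge0 t) Xt.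
rewrite /dual_gap_seq /primal_seq Pu.
have cL := strongly_concaveW (m_le t)
  (regularized_payoff_strongly_concave HS (y 0%N) (beta t) Xt).
apply: (projected_gradient_contraction (Y_convex HS) sL cL) PO_t => //.
- by rewrite addr_ge0 // (Lyy_ge0 HS).
- by rewrite ltW ?s_le1.
Qed.

Lemma primal_seq_beta t :
  primal_seq t.+1 <= reg_primal Y L (y 0%N) (beta t) (x t.+1)
    + (beta t - beta t.+1) / 2 * D ^+ 2.
Proof.
apply: (reg_primal_antitone HS YD) => //; first exact: (run_in_domain 0).2.
exact: (run_in_domain _).1.
Qed.

(** The dual step contracts the gap by 1 - s. Moving x changes the maximum and the
    current value by almost the same amount, because the two gradients differ by
    the dual distance only; half of the contraction absorbs that difference. *)
Lemma dual_gap_seq_step t :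
  dual_gap_seq t.+1 <= (1 - s t / 2) * dual_gap_seq t
    + (Lxx / 2 + Lyx ^+ 2 / (2 * m t) + Lyx ^+ 2 / (m t * s t))
      * (tau t ^+ 2 * D ^+ 2)
    + (beta t - beta t.+1) / 2 * D ^+ 2.
Proof.
have [Xt Yt] := run_in_domain t; have [Xt' Yt'] := run_in_domain t.+1.
have half := dual_gap_seq_half_step t.
have pos := dual_gap_seq_ge0 t.
have r0 : 0 < s t / 2 by rewrite divr_gt0.
have := reg_primal_le_model HS (y 0%N) (beta_ge0 t) (m_gt0 t) (m_le t) r0 Xt Xt' Yt'.
have tan := payoff_ge_tangent HS HX Yt' Xt Xt'.
have drift := primal_seq_beta t.
have Ek : 2 * m t * (s t / 2) = m t * s t by field.
rewrite Ek; set K := Lxx / 2 + _ + _.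
have K0 : 0 <= K.
  by rewrite /K !addr_ge0 ?divr_ge0 ?sqr_ge0 ?mulr_ge0 ?(Lxx_ge0 HS) ?ltW.
have := ler_wpM2l K0 (run_displacement t).
have : (1 + s t / 2) * (primal_seq t - regularized L (y 0%N) (beta t) (x t) (y t.+1))
    <= (1 - s t / 2) * dual_gap_seq t.
  have c0 : 0 <= 1 + s t / 2 by lra.
  apply: le_trans (ler_wpM2l c0 half) _.
  rewrite mulrA ler_wpM2r //.
  by have := s_gt0 t; nra.
have : (beta t.+1) / 2 * enorm (y t.+1 - y 0%N) ^+ 2 <=
       beta t / 2 * enorm (y t.+1 - y 0%N) ^+ 2.
  by rewrite ler_wpM2r ?sqr_ge0 // ler_pM2r // beta_antitone.
move: drift tan; rewrite /dual_gap_seq /primal_seq /regularized.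
lra.
Qed.

(** The Frank-Wolfe step. The oracle direction is compared with an arbitrary
    competitor w through the convex function L(., y t), whose gradient the oracle
    was given; r balances the two error terms. *)
Lemma primal_seq_step t w r : X w -> 0 < r ->
  primal_seq t.+1 <= (1 - tau t) * primal_seq t + tau t * primal Y L w
    + tau t * ((1 + r) * dual_gap_seq t + Lyx ^+ 2 / (2 * m t * r) * D ^+ 2)
    + tau t ^+ 2 * ((Lxx / 2 + Lyx ^+ 2 / (2 * m t)) * D ^+ 2)
    + (beta t - beta t.+1) / 2 * D ^+ 2.
Proof.
move=> Xw r0.
have [Xt Yt] := run_in_domain t; have [Xt' Yt'] := run_in_domain t.+1.
have tr0 := mulr_gt0 (tau_gt0 t) r0.
have M := reg_primal_le_model HS (y 0%N) (beta_ge0 t) (m_gt0 t) (m_le t) tr0 Xt Xt' Yt.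
have tan := payoff_ge_tangent HS HX Yt Xt Xw.
have wle := payoff_le_primal HS Xw Yt.
have drift := primal_seq_beta t.
have lmo : dot (grad_x L (x t) (y t)) (x t.+1 - x t) <=
    tau t * dot (grad_x L (x t) (y t)) (w - x t).
  have [_ _ step] := Hrun; have [[v [_ /(_ _ Xw) vw] ->] _] := step t.
  by rewrite addrAC subrr add0r dotZr ler_pM2l // !dotDr lerD2r.
have D2 := run_displacement t.
have K0 : 0 <= Lxx / 2 + Lyx ^+ 2 / (2 * m t) + Lyx ^+ 2 / (2 * m t * (tau t * r)).
  by rewrite !addr_ge0 ?divr_ge0 ?sqr_ge0 ?mulr_ge0 ?(Lxx_ge0 HS) ?ltW.
have := ler_wpM2l K0 D2.
have -> : (Lxx / 2 + Lyx ^+ 2 / (2 * m t) + Lyx ^+ 2 / (2 * m t * (tau t * r)))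
    * (tau t ^+ 2 * D ^+ 2) = tau t ^+ 2 * ((Lxx / 2 + Lyx ^+ 2 / (2 * m t)) * D ^+ 2)
    + tau t * (Lyx ^+ 2 / (2 * m t * r) * D ^+ 2).
  by field; rewrite !gt_eqF.
have reg_le : regularized L (y 0%N) (beta t) (x t) (y t) <= L (x t) (y t).
  by rewrite gerBl mulr_ge0 ?sqr_ge0 ?divr_ge0.
have : tau t * dot (grad_x L (x t) (y t)) (w - x t) <=
    tau t * (primal Y L w - primal_seq t + dual_gap_seq t).
  by rewrite ler_pM2l // /dual_gap_seq; lra.
move: M drift; rewrite /dual_gap_seq /primal_seq => M drift.
lra.
Qed.

Definition opt_gap_seq t := primal_seq t - inf [set primal Y L v | v in X].

(** Solved for the value of the competitor, primal_seq_step is a lower bound common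
    to all competitors, hence a lower bound of the infimum. *)
Lemma opt_gap_seq_step t r : 0 < r ->
  opt_gap_seq t.+1 <= (1 - tau t) * opt_gap_seq t
    + tau t * ((1 + r) * dual_gap_seq t + Lyx ^+ 2 / (2 * m t * r) * D ^+ 2)
    + tau t ^+ 2 * ((Lxx / 2 + Lyx ^+ 2 / (2 * m t)) * D ^+ 2)
    + (beta t - beta t.+1) / 2 * D ^+ 2.
Proof.
move=> r0; rewrite /opt_gap_seq.
set E1 := tau t * (_ + _); set E2 := tau t ^+ 2 * _; set E3 := _ / 2 * _.
set I := inf _.
have : (primal_seq t.+1 - (1 - tau t) * primal_seq t - E1 - E2 - E3) / tau t <= I.
  apply: lb_le_inf; first by have [w Xw] := X_nonempty HS; exists (primal Y L w), w.
  move=> _ [w Xw <-]; rewrite ler_pdivrMr //.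
  by have := primal_seq_step t Xw r0; rewrite -/E1 -/E2 -/E3; lra.
by rewrite ler_pdivrMr //; lra.
Qed.

Lemma primal_le_primal_seq t :
  primal Y L (x t) <= primal_seq t + beta t / 2 * D ^+ 2.
Proof.
have := reg_primal_antitone HS YD (run_in_domain 0).2 (lexx 0) (beta_ge0 t) (run_in_domain t).1.
by rewrite reg_primal0 subr0.
Qed.

Lemma gap_opt_le t : gap_opt X Y L (x t) <= opt_gap_seq t + beta t / 2 * D ^+ 2.
Proof.
by have := primal_le_primal_seq t; rewrite /gap_opt /opt_gap_seq; lra.
Qed.

Lemma gap_dual_le t :
  gap_dual Y L (x t) (y t) <= dual_gap_seq t + beta t / 2 * D ^+ 2.
Proof.
have : regularized L (y 0%N) (beta t) (x t) (y t) <= L (x t) (y t).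
  by rewrite gerBl mulr_ge0 ?sqr_ge0 ?divr_ge0.
have := primal_le_primal_seq t.
by rewrite /gap_dual /dual_gap_seq /primal; lra.
Qed.

End Run.

(** * Recursions and rates *)

(** A contraction by 1 - c q follows any positive reference sequence r that is
    itself decreasing at most half as fast: the other half of the contraction
    absorbs a perturbation of order q r. *)
Lemma perturbed_contraction (R : realType) (e q r : nat -> R) (c A : R) :
  0 < c -> 0 <= A -> (forall t, 0 <= q t) -> (forall t, c * q t <= 1) ->
  (forall t, 0 < r t) ->
  (forall t, e t.+1 <= (1 - c * q t) * e t + A * (q t * r t)) ->
  (forall t, r t - r t.+1 <= c / 2 * (q t * r t)) ->
  exists2 K, 0 <= K & forall t, e t <= K * r t.
Proof.
move=> c0 A0 q0 cq r0 step slow.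
set K := `|e 0%N| / r 0%N + 2 * A / c.
have K1 : 0 <= `|e 0%N| / r 0%N by rewrite divr_ge0 // ltW.
have K2 : 0 <= 2 * A / c by rewrite divr_ge0 ?mulr_ge0 // ltW.
have K0 : 0 <= K by rewrite addr_ge0.
exists K => //; elim=> [|t IH].
  rewrite /K mulrDl divfK ?gt_eqF // (le_trans (ler_norm _)) // lerDl.
  by rewrite mulr_ge0 // ltW.
apply: le_trans (step t) _.
have k0 : 0 <= 1 - c * q t by rewrite subr_ge0.
have := ler_wpM2l k0 IH; have := ler_wpM2l K0 (slow t).
have qr : 0 <= q t * r t by rewrite mulr_ge0 // ltW.
have AK : A <= c / 2 * K.
  have -> : A = c / 2 * (2 * A / c) by field; rewrite gt_eqF.
  by rewrite ler_wpM2l ?divr_ge0 ?(ltW c0) // lerDr.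
have := ler_wpM2r qr AK; lra.
Qed.

Lemma power_decay1 (R : realType) t : @power_decay R 1 t = t.+1%:R^-1.
Proof. by rewrite /power_decay powRN powRr1. Qed.

Lemma power_decay1_gt0 (R : realType) t : 0 < @power_decay R 1 t.
Proof. by rewrite power_decay1 invr_gt0 ltr0n. Qed.

Lemma power_decay1_le1 (R : realType) t : @power_decay R 1 t <= 1.
Proof. by rewrite power_decay1 invf_le1 ?ltr0n // ler1n. Qed.

(** With step 1 / (t + 1) the quantity t * h t telescopes. *)
Lemma averaging_recursion (R : realType) (h q : nat -> R) (B : R) :
  (forall t, h t.+1 <= (1 - power_decay 1 t) * h t + power_decay 1 t * (B * q t)) ->
  forall t, h t.+1 <= B * (t.+1%:R^-1 * \sum_(i < t.+1) q i).
Proof.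
move=> step t; have n0 k : 0 < k.+1%:R :> R by rewrite ltr0n.
have tel k : k%:R * h k <= B * \sum_(i < k) q i.
  elim: k => [|k IH]; first by rewrite mul0r big_ord0 mulr0.
  have := step k; rewrite power_decay1 -(ler_pM2l (n0 k)).
  have -> : k.+1%:R * ((1 - k.+1%:R^-1) * h k + k.+1%:R^-1 * (B * q k)) =
      k%:R * h k + B * q k.
    by rewrite -natr1; field; rewrite natr1 gt_eqF.
  move=> H; apply: le_trans H _; rewrite big_ord_recr /= mulrDr.
  by rewrite lerD2r.
by rewrite mulrCA ler_pdivlMl // tel.
Qed.

Lemma average_le (R : realType) (u q : nat -> R) (K : R) :
  (forall t, u t.+1 <= K * q t) ->
  forall t, average u t.+1 <= K * (t.+1%:R^-1 * \sum_(i < t.+1) q i).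
Proof.
move=> uq t; rewrite /average mulrCA ler_wpM2l ?invr_ge0 //.
by rewrite big_add1 /= big_mkord mulr_sumr ler_sum.
Qed.

Section Cube_root_decay.
Context {R : realType}.
Let p := @power_decay R (1 / 3).

Lemma decay3_gt0 t : 0 < p t. Proof. by rewrite powR_gt0. Qed.

Lemma decay3_cube t : p t ^+ 3 = t.+1%:R^-1.
Proof.
rewrite -powR_mulrn ?ltW ?decay3_gt0 // /p /power_decay -powRrM.
have -> : - (1 / 3) * 3 = - 1 :> R by field.
by rewrite powRN powRr1.
Qed.

Lemma decay3_le1 t : p t <= 1.
Proof.
rewrite -(@ler_pXn2r _ 3) ?nnegrE ?ler01 ?(ltW (decay3_gt0 _)) // decay3_cube expr1n.
by rewrite invf_le1 ?ltr0n // ler1n.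
Qed.

Lemma decay3_antitone t : p t.+1 <= p t.
Proof.
rewrite -(@ler_pXn2r _ 3) ?nnegrE ?ler01 ?(ltW (decay3_gt0 _)) // !decay3_cube.
by rewrite lef_pV2 ?posrE ?ltr0n // ler_nat.
Qed.

Lemma decay3_inv_cubeS t : (p t.+1)^-1 ^+ 3 = (p t)^-1 ^+ 3 + 1.
Proof. by rewrite !exprVn !decay3_cube !invrK natr1. Qed.

(** Between consecutive times p^(-3) increases by one, so p^3 decreases by
    p_t^3 p_(t+1)^3 <= p_t^6, and the difference of cubes is at least p_t^2 times
    the difference. *)
Lemma decay3_diff t : p t - p t.+1 <= p t ^+ 4.
Proof.
have p0 := decay3_gt0 t; have p1 := decay3_gt0 t.+1; have le := decay3_antitone t.
have := decay3_inv_cubeS t; move: p0 p1 le.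
move: (p t) (p t.+1) => a b a0 b0 ba E.
have E' : a ^+ 3 - b ^+ 3 = a ^+ 3 * b ^+ 3.
  transitivity (a ^+ 3 * b ^+ 3 * (b^-1 ^+ 3 - a^-1 ^+ 3)).
    by field; rewrite !gt_eqF.
  by rewrite E; ring.
have a2 : 0 < a ^+ 2 by rewrite exprn_gt0.
have ba3 : b ^+ 3 <= a ^+ 3 by rewrite ler_pXn2r ?nnegrE ?(ltW a0) ?(ltW b0).
have H1 : a ^+ 3 * b ^+ 3 <= a ^+ 3 * a ^+ 3 by rewrite ler_pM2l // exprn_gt0.
have H2 : 0 <= (a - b) * (a * b + b ^+ 2).
  by rewrite mulr_ge0 ?subr_ge0 // addr_ge0 ?sqr_ge0 // mulr_ge0 // ltW.
rewrite -(ler_pM2l a2).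
have -> : a ^+ 2 * a ^+ 4 = a ^+ 3 * a ^+ 3 by ring.
have -> : a ^+ 2 * (a - b) = a ^+ 3 - b ^+ 3 - (a - b) * (a * b + b ^+ 2) by ring.
lra.
Qed.

(** A rate 1 / (t + 1) decays slowly against the contraction 1 - c / (t + 1)^(1/3)
    only for large t; the shift by a constant makes it so from the start. *)
Lemma shifted_inverse_slow_decay (c : R) t
    (r := fun k : nat => (k.+1%:R + (2 / c) ^+ 2)^-1) :
  0 < c -> r t - r t.+1 <= c / 2 * (p t * r t).
Proof.
move=> c0; rewrite /r; set d := 2 / c; set N := d ^+ 2.
have d0 : 0 < d by exact: divr_gt0.
have N0 : 0 < N by exact: exprn_gt0.
have nN : 0 < t.+1%:R + N by rewrite addr_gt0 // ltr0n.
have rdec : (t.+1%:R + N)^-1 - (t.+2%:R + N)^-1 <=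
    (t.+1%:R + N)^-1 * (t.+1%:R + N)^-1.
  rewrite -[t.+2%:R]natr1; move: nN; move: (t.+1%:R : R) => n nN0.
  have nN1 : 0 < n + 1 + N by lra.
  rewrite -subr_ge0.
  have -> : (n + N)^-1 * (n + N)^-1 - ((n + N)^-1 - (n + 1 + N)^-1) =
      (n + N)^-1 ^+ 2 * (n + 1 + N)^-1 by field; rewrite !gt_eqF.
  by rewrite mulr_ge0 ?sqr_ge0 // invr_ge0 ltW.
apply: le_trans rdec _.
rewrite mulrA ler_pM2r ?invr_gt0 //.
(* With a = 1 / p t, at least 1, the claim is d a <= a ^ 3 + d ^ 2. *)
have E : t.+1%:R = (p t)^-1 ^+ 3 by rewrite exprVn decay3_cube invrK.
have a1 : 1 <= (p t)^-1 by rewrite invf_ge1 ?decay3_le1 ?decay3_gt0.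
have -> : c / 2 * p t = (d * (p t)^-1)^-1.
  by rewrite /d; field; rewrite !gt_eqF ?decay3_gt0.
have a0 : 0 < (p t)^-1 by rewrite invr_gt0 decay3_gt0.
have da0 := mulr_gt0 d0 a0.
rewrite lef_pV2 ?posrE // E /N.
move: (p t)^-1 a1 a0 {da0 E nN} => a a1 a0.
have [da|ad] := leP d a.
  have : d * a <= a * a by rewrite ler_pM2r.
  have : a * a <= a * a * a by rewrite ler_peMr // mulr_ge0 // ltW.
  by rewrite !exprS expr0; have := sqr_ge0 d; rewrite expr2; lra.
have : d * a <= d * d by rewrite ler_pM2l // ltW.
by have := exprn_gt0 3 a0; rewrite expr2; lra.
Qed.

(** The sum of n^(-1/3) is at most 3/2 n^(2/3); in terms of a = n^(1/3) and
    b = (n + 1)^(1/3) the induction step is (b - a)^2 (b + 2 a) >= 0. *)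
Lemma decay3_sum t : t.+1%:R^-1 * \sum_(i < t.+1) p i <= 3 / 2 * p t.
Proof.
suff H : \sum_(i < t.+1) p i <= 3 / 2 * (p t)^-1 ^+ 2.
  rewrite -decay3_cube.
  have -> : 3 / 2 * p t = p t ^+ 3 * (3 / 2 * (p t)^-1 ^+ 2).
    by field; rewrite gt_eqF ?decay3_gt0.
  by rewrite ler_pM2l // exprn_gt0 // decay3_gt0.
elim: t => [|t IH].
  rewrite big_ord_recr big_ord0 /= add0r.
  by rewrite /p /power_decay powR1 invr1 expr1n mulr1; lra.
rewrite big_ord_recr /=; apply: le_trans (lerD IH (lexx _)) _.
have := decay3_inv_cubeS t.
have := decay3_gt0 t; have := decay3_gt0 t.+1.
rewrite -[X in _ + X <= _](invrK (p t.+1)) -(invr_gt0 (p t)) -(invr_gt0 (p t.+1)).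
move: (p t)^-1 (p t.+1)^-1 => a b b0 a0 E.
rewrite -(ler_pM2r b0) mulrDl mulVf ?gt_eqF // -subr_ge0.
have -> : 3 / 2 * b ^+ 2 * b - (3 / 2 * a ^+ 2 * b + 1) =
    (b - a) ^+ 2 * (b + 2 * a) / 2 + (b ^+ 3 - (a ^+ 3 + 1)) by field.
by rewrite E subrr addr0 divr_ge0 // mulr_ge0 ?sqr_ge0 //; lra.
Qed.

End Cube_root_decay.

Lemma shifted_inverse_square_slow_decay (R : realType) (c : R) t
    (r := fun k : nat => (k.+1%:R + 4 / c)^-1 ^+ 2) :
  0 < c -> r t - r t.+1 <= c / 2 * r t.
Proof.
move=> c0; rewrite /r; set N := 4 / c; rewrite -[t.+2%:R]natr1.
have N0 : 0 < N by exact: divr_gt0.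
have : 4 / c <= t.+1%:R + N by rewrite lerDr.
rewrite ler_pdivrMr //.
have -> : t.+1%:R + 1 + N = t.+1%:R + N + 1 :> R by ring.
have : 0 < t.+1%:R + N by rewrite addr_gt0 // ltr0n.
move: (t.+1%:R + N) => n nn0 n4.
have n1 : 0 < n + 1 by lra.
rewrite -subr_ge0.
have -> : c / 2 * n^-1 ^+ 2 - (n^-1 ^+ 2 - (n + 1)^-1 ^+ 2) =
  (c / 2 * (n + 1) ^+ 2 - (2 * n + 1)) * (n^-1 ^+ 2 * (n + 1)^-1 ^+ 2).
  by field; rewrite !gt_eqF.
apply: mulr_ge0; last by apply: mulr_ge0; exact: sqr_ge0.
by have := c0; nra.
Qed.

(** Each 1 / (t + 1) is at most 3 / (t + 3), and 1 / (t + 3) is at most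
    ln (t + 3) - ln (t + 2). *)
Lemma harmonic_sum_le_ln (R : realType) t :
  \sum_(i < t) @power_decay R 1 i <= 3 * ln t.+2%:R.
Proof.
elim: t => [|t IH]; first by rewrite big_ord0 mulr_ge0 // ln_ge0 // ler1n.
rewrite big_ord_recr /= power_decay1.
have n2 k : 0 < k.+1%:R :> R by rewrite ltr0n.
have q1 : -1 < - t.+3%:R^-1 :> R by rewrite ltrN2 invf_lt1 // ltr1n.
have := le_ln1Dx q1.
have -> : 1 - t.+3%:R^-1 = t.+2%:R / t.+3%:R :> R.
  rewrite -[t.+3%:R]natr1; move: (n2 t.+1); move: (t.+2%:R : R) => n n0.
  by field; rewrite gt_eqF // addr_gt0.
rewrite ln_div ?posrE // => lnle.
have : t.+1%:R^-1 <= 3 * t.+3%:R^-1 :> R.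
  rewrite ler_pdivlMr // mulrC ler_pdivrMr // -natrM ler_nat.
  by rewrite mulnS (leq_add2l 3 t) leq_pmull.
move: lnle IH; move: (ln t.+2%:R) (ln t.+3%:R) (t.+3%:R^-1) => a b c.
by move: (t.+1%:R^-1 : R) (bigop _ _ _) => d e; lra.
Qed.

(** Comparison with the telescoping sum of 1 / (t + 1) - 1 / (t + 2). *)
Lemma inverse_square_sum_le1 (R : realType) t :
  \sum_(i < t) (@power_decay R 1 i.+1) ^+ 2 <= 1.
Proof.
suff H : \sum_(i < t) (@power_decay R 1 i.+1) ^+ 2 <= 1 - t.+1%:R^-1.
  by apply: le_trans H _; rewrite gerBl invr_ge0.
elim: t => [|t IH]; first by rewrite big_ord0 invr1 subrr.
rewrite big_ord_recr /=; apply: le_trans (lerD IH (lexx _)) _.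
rewrite power_decay1 -[t.+2%:R]natr1.
have : 0 < t.+1%:R :> R by rewrite ltr0n.
move: (t.+1%:R : R) => n n0.
rewrite -subr_ge0.
have -> : 1 - (n + 1)^-1 - (1 - n^-1 + (n + 1)^-1 ^+ 2) = n^-1 * (n + 1)^-1 ^+ 2.
  by field; rewrite !gt_eqF // addr_gt0.
by rewrite mulr_ge0 ?sqr_ge0 // invr_ge0 ltW.
Qed.

(** * The two regimes *)

Local Ltac nonneg := repeat
  first [done | exact: sqr_ge0 | apply: addr_ge0 | apply: divr_ge0 | apply: mulr_ge0].

Section Vanishing_regularization.
Context {R : realType} {dx dy : nat} {X : set 'rV[R]_dx} {Y : set 'rV[R]_dy}
  {L : 'rV[R]_dx -> 'rV[R]_dy -> R} {mu Lxx Lyy Lyx : R}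
  (HS : standing_assumption X Y L mu Lxx Lyy Lyx)
  (HX : forall y, Y y -> convex_function X (fun x => L x y))
  {C D : R} {x : nat -> 'rV[R]_dx} {y : nat -> 'rV[R]_dy} (C0 : 0 < C)
  (Hrun : lmo_po_run X Y L Lyy (power_decay 1)
    (fun t => C * power_decay (1 / 3) t) x y)
  (XD : forall u v, X u -> X v -> enorm (u - v) <= D)
  (YD : forall u v, Y u -> Y v -> enorm (u - v) <= D).

Let p := @power_decay R (1 / 3).
Let tau := @power_decay R 1.
Let beta t := C * p t.
Let c := C / (Lyy + C).
Let g := dual_gap_seq (Y := Y) (L := L) (beta := beta) (x := x) (y := y).
Let h := opt_gap_seq (X := X) (Y := Y) (L := L) (beta := beta) (x := x) (y := y).

Let p_gt0 t : 0 < p t. Proof. exact: decay3_gt0. Qed.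
Let p_ge0 t : 0 <= p t. Proof. exact: ltW. Qed.
Let p_le1 t : p t <= 1. Proof. exact: decay3_le1. Qed.

Let p_cube t : p t ^+ 3 = tau t.
Proof. by rewrite decay3_cube /tau power_decay1. Qed.

Let p_antitoneX t i j : (i <= j)%N -> p t ^+ j <= p t ^+ i.
Proof. by move=> ij; rewrite ler_wiXn2l. Qed.

Let C_ge0 : 0 <= C. Proof. exact: ltW. Qed.
Let Lyy_ge : 0 <= Lyy. Proof. exact: Lyy_ge0 HS. Qed.
Let Lxx_ge : 0 <= Lxx. Proof. exact: Lxx_ge0 HS. Qed.

Let LyyC_gt0 : 0 < Lyy + C. Proof. by rewrite ltr_wpDl. Qed.
Let c_gt0 : 0 < c. Proof. exact: divr_gt0. Qed.
Let c_ge0 : 0 <= c. Proof. exact: ltW. Qed.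
Let c_le1 : c <= 1. Proof. by rewrite ler_pdivrMr // mul1r lerDr. Qed.

Let beta_ge0 t : 0 <= beta t. Proof. exact: mulr_ge0. Qed.
Let beta_gt0 t : 0 < beta t. Proof. exact: mulr_gt0. Qed.

Let beta_antitone t : beta t.+1 <= beta t.
Proof. by rewrite ler_pM2l // decay3_antitone. Qed.

Let beta_le t : beta t <= mu + beta t.
Proof. by rewrite lerDr (mu_ge0 HS). Qed.

Let s_gt0 t : 0 < c * p t. Proof. exact: mulr_gt0. Qed.
Let s_le1 t : c * p t <= 1. Proof. exact: mulr_ile1. Qed.

Let s_le t : c * p t * (Lyy + beta t) <= beta t.
Proof.
rewrite mulrAC ler_pM2r // /c mulrAC ler_pdivrMr // ler_pM2l // lerD2l.
by rewrite /beta ler_piMr.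
Qed.

(** The modulus and the contraction are both of order p, so that the displacement
    tau ^ 2 = p ^ 6 costs p ^ 6 / p ^ 2 = p ^ 4, which is also the order of the
    drift of beta. Against a contraction by 1 - c p this leaves a dual gap of
    order p ^ 4 / p. *)
Lemma vanishing_dual_gap : exists2 K, 0 <= K & forall t, g t <= K * p t ^+ 3.
Proof.
pose N := (2 / (c / 2)) ^+ 2; pose r (t : nat) := (t.+1%:R + N)^-1.
have N0 : 0 < N by rewrite exprn_gt0 // divr_gt0 // divr_gt0.
have n0 t : 0 < t.+1%:R :> R by rewrite ltr0n.
have nN t : 0 < t.+1%:R + N by rewrite addr_gt0.
have tauE t : tau t = t.+1%:R^-1 by exact: power_decay1.
have D2 := sqr_ge0 D.
suff [K K0 gle] : exists2 K, 0 <= K & forall t, g t <= K * r t.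
  exists K => // t; apply: le_trans (gle t) _; rewrite ler_wpM2l // p_cube tauE.
  by rewrite lef_pV2 ?posrE // lerDl ltW.
pose A := (Lxx / 2 + Lyx ^+ 2 / (2 * C) + Lyx ^+ 2 / (C * c)) * D ^+ 2
  + C / 2 * D ^+ 2.
have A_ge0 : 0 <= A by rewrite /A; nonneg.
apply: (@perturbed_contraction _ g p r (c / 2) (A * (1 + N))) => //.
- exact: divr_gt0.
- by rewrite mulr_ge0 // addr_ge0 // ltW.
- by move=> t; have := s_le1 t; have := s_gt0 t; lra.
- by move=> t; rewrite invr_gt0.
- move=> t; have := dual_gap_seq_step HS HX Hrun (power_decay1_gt0 R)
    (power_decay1_le1 R) beta_ge0 beta_antitone beta_gt0 beta_le s_gt0 s_le1
    s_le XD YD t.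
  rewrite -/(g t) -/(g t.+1) -/tau -p_cube => /le_trans; apply.
  have -> : 1 - c * p t / 2 = 1 - c / 2 * p t by field.
  rewrite -addrA lerD2l.
  have p4 : p t ^+ 4 <= (1 + N) * (p t * r t).
    have -> : p t ^+ 4 = p t * p t ^+ 3 by ring.
    rewrite [leRHS]mulrCA ler_pM2l // p_cube tauE.
    rewrite ler_pdivlMr // mulrC ler_pdivrMr //.
    have : 1 <= t.+1%:R :> R by rewrite ler1n.
    by have := N0; nra.
  rewrite -[leRHS]mulrA; apply: le_trans (ler_wpM2l A_ge0 p4).
  have -> : A * p t ^+ 4 = (Lxx / 2 * p t ^+ 4 + Lyx ^+ 2 / (2 * C) * p t ^+ 4
     + Lyx ^+ 2 / (C * c) * p t ^+ 4) * D ^+ 2 + C / 2 * p t ^+ 4 * D ^+ 2.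
    by rewrite /A; ring.
  apply: lerD; last first.
    by rewrite ler_wpM2r // -mulrBr mulrAC ler_wpM2l ?decay3_diff //; nonneg.
  rewrite mulrA ler_wpM2r //.
  have -> : (Lxx / 2 + Lyx ^+ 2 / (2 * beta t) + Lyx ^+ 2 / (beta t * (c * p t)))
      * p t ^+ 3 ^+ 2 = Lxx / 2 * p t ^+ 6 + Lyx ^+ 2 / (2 * C) * p t ^+ 5
      + Lyx ^+ 2 / (C * c) * p t ^+ 4.
    by rewrite /beta; field; rewrite !gt_eqF.
  by rewrite lerD2r; apply: lerD; rewrite ler_wpM2l ?p_antitoneX //; nonneg.
- by move=> t; apply: shifted_inverse_slow_decay; exact: divr_gt0.
Qed.

(** The choice r = 1 / p ^ 2 equalizes the error terms r p ^ 3 and 1 / (p r). *)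
Lemma vanishing_opt_gap_step K : 0 <= K -> (forall t, g t <= K * p t ^+ 3) ->
  exists B, forall t, h t.+1 <= (1 - tau t) * h t + tau t * (B * p t).
Proof.
move=> K0 gp; have D2 := sqr_ge0 D.
exists (2 * K + Lyx ^+ 2 / (2 * C) * D ^+ 2
  + (Lxx / 2 + Lyx ^+ 2 / (2 * C)) * D ^+ 2 + C / 2 * D ^+ 2) => t.
have r0 : 0 < (p t)^-1 ^+ 2 by rewrite exprn_gt0 ?invr_gt0.
have := opt_gap_seq_step HS HX Hrun (power_decay1_gt0 R) (power_decay1_le1 R)
  beta_ge0 beta_antitone beta_gt0 beta_le XD YD t r0.
rewrite -/(h t) -/(h t.+1) -/(g t) -/tau => /le_trans; apply.
rewrite -!addrA lerD2l.
have -> : tau t * ((2 * K + (Lyx ^+ 2 / (2 * C) * D ^+ 2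
    + ((Lxx / 2 + Lyx ^+ 2 / (2 * C)) * D ^+ 2 + C / 2 * D ^+ 2))) * p t) =
  tau t * (2 * K * p t + Lyx ^+ 2 / (2 * C) * D ^+ 2 * p t)
    + (tau t * ((Lxx / 2 * p t + Lyx ^+ 2 / (2 * C) * p t) * D ^+ 2)
       + C / 2 * (tau t * p t) * D ^+ 2) by ring.
have tau0 : 0 < tau t := power_decay1_gt0 R t.
apply: lerD; last apply: lerD.
- rewrite ler_pM2l //; apply: lerD.
    have r1 : 0 <= 1 + (p t)^-1 ^+ 2 by rewrite addr_ge0 // ltW.
    apply: le_trans (ler_wpM2l r1 (gp t)) _.
    have -> : (1 + (p t)^-1 ^+ 2) * (K * p t ^+ 3) = K * (p t ^+ 3 + p t ^+ 1).
      by field; rewrite gt_eqF.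
    have -> : 2 * K * p t = K * (p t ^+ 1 + p t ^+ 1) by ring.
    by rewrite ler_wpM2l // lerD2r p_antitoneX.
  have -> // : Lyx ^+ 2 / (2 * beta t * (p t)^-1 ^+ 2) * D ^+ 2 =
    Lyx ^+ 2 / (2 * C) * D ^+ 2 * p t by rewrite /beta; field; rewrite !gt_eqF.
- have -> : tau t ^+ 2 = tau t * tau t by ring.
  rewrite -mulrA ler_pM2l // mulrA ler_wpM2r // -p_cube.
  have -> : p t ^+ 3 * (Lxx / 2 + Lyx ^+ 2 / (2 * beta t)) =
      Lxx / 2 * p t ^+ 3 + Lyx ^+ 2 / (2 * C) * p t ^+ 2.
    by rewrite /beta; field; rewrite !gt_eqF.
  rewrite -[X in Lxx / 2 * X + _ * X]expr1.
  by apply: lerD; rewrite ler_wpM2l ?p_antitoneX //; nonneg.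
- rewrite ler_wpM2r // -mulrBr mulrAC ler_wpM2l //; first by nonneg.
  have -> : tau t * p t = p t ^+ 4 by rewrite -p_cube; ring.
  exact: decay3_diff.
Qed.

Let regularization_bias t : beta t.+1 / 2 * D ^+ 2 <= C / 2 * D ^+ 2 * p t.
Proof.
have -> : C / 2 * D ^+ 2 * p t = beta t / 2 * D ^+ 2 by rewrite /beta; ring.
by rewrite ler_wpM2r ?sqr_ge0 // ler_pM2r.
Qed.

Lemma vanishing_regularization_rates :
  rate_Otilde (fun T => gap_opt X Y L (x T)) (fun T => T%:R `^ (- (1 / 3))) /\
  rate_O (average (fun t => gap_dual Y L (x t) (y t)))
    (fun T => T%:R `^ (- (1 / 3))).
Proof.
have [K K0 gp] := vanishing_dual_gap.
split.
  have [B hstep] := vanishing_opt_gap_step K0 gp.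
  exists (`|B| * (3 / 2) + C / 2 * D ^+ 2), 0%N => -[//|t] _.
  rewrite expr0 mulr1 -/(power_decay (1 / 3) t) -/(p t).
  apply: le_trans (gap_opt_le HS Hrun (power_decay1_gt0 R) (power_decay1_le1 R)
    beta_ge0 YD t.+1) _.
  rewrite -/(h t.+1) mulrDl; apply: lerD.
    apply: le_trans (averaging_recursion hstep t) _.
    have S0 : 0 <= t.+1%:R^-1 * \sum_(i < t.+1) p i.
      by rewrite mulr_ge0 ?invr_ge0 // sumr_ge0.
    apply: le_trans (ler_wpM2r S0 (ler_norm B)) _.
    by rewrite -mulrA ler_wpM2l // decay3_sum.
  exact: regularization_bias.
exists ((K + C / 2 * D ^+ 2) * (3 / 2)) => -[//|t] _.
rewrite -/(power_decay (1 / 3) t) -/(p t) -[leRHS]mulrA.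
have Gp k : gap_dual Y L (x k.+1) (y k.+1) <= (K + C / 2 * D ^+ 2) * p k.
  apply: le_trans (gap_dual_le HS Hrun (power_decay1_gt0 R) (power_decay1_le1 R)
    beta_ge0 YD k.+1) _.
  rewrite -/(g k.+1) mulrDl; apply: lerD.
    apply: le_trans (gp _) _; rewrite ler_wpM2l //.
    apply: le_trans (p_antitoneX _ (isT : 1 <= 3)%N) _.
    exact: decay3_antitone.
  exact: regularization_bias.
apply: le_trans (average_le (u := fun k => gap_dual Y L (x k) (y k)) Gp t) _.
by rewrite ler_wpM2l ?decay3_sum //; nonneg.
Qed.

End Vanishing_regularization.

Section Strongly_concave.
Context {R : realType} {dx dy : nat} {X : set 'rV[R]_dx} {Y : set 'rV[R]_dy}
  {L : 'rV[R]_dx -> 'rV[R]_dy -> R} {mu Lxx Lyy Lyx : R}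
  (HS : standing_assumption X Y L mu Lxx Lyy Lyx)
  (HX : forall y, Y y -> convex_function X (fun x => L x y))
  {D : R} {x : nat -> 'rV[R]_dx} {y : nat -> 'rV[R]_dy} (mu_gt0 : 0 < mu)
  (Hrun : lmo_po_run X Y L Lyy (power_decay 1) (fun=> 0) x y)
  (XD : forall u v, X u -> X v -> enorm (u - v) <= D)
  (YD : forall u v, Y u -> Y v -> enorm (u - v) <= D).

Let tau := @power_decay R 1.
Let c := mu / (Lyy + mu).
Let g := dual_gap_seq (Y := Y) (L := L) (beta := fun=> 0) (x := x) (y := y).
Let h := opt_gap_seq (X := X) (Y := Y) (L := L) (beta := fun=> 0) (x := x) (y := y).

Let mu_ge : 0 <= mu. Proof. exact: ltW. Qed.
Let Lyy_ge : 0 <= Lyy. Proof. exact: Lyy_ge0 HS. Qed.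
Let Lxx_ge : 0 <= Lxx. Proof. exact: Lxx_ge0 HS. Qed.
Let Lyymu_gt0 : 0 < Lyy + mu. Proof. by rewrite ltr_wpDl. Qed.
Let c_gt0 : 0 < c. Proof. exact: divr_gt0. Qed.
Let c_ge0 : 0 <= c. Proof. exact: ltW. Qed.
Let c_le1 : c <= 1. Proof. by rewrite ler_pdivrMr // mul1r lerDr. Qed.
Let mu_le : mu <= mu + 0. Proof. by rewrite addr0. Qed.

Let c_le : c * (Lyy + 0) <= mu.
Proof. by rewrite addr0 /c mulrAC ler_pdivrMr // ler_pM2l // lerDl. Qed.

(** The dual step now contracts by a constant factor, so the dual gap is of the
    order of the squared displacement, and its sum over time converges. *)
Lemma strongly_concave_dual_gap :
  exists2 K, 0 <= K & forall t, g t <= K * tau t ^+ 2.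
Proof.
pose N := 4 / (c / 2); pose r (t : nat) := (t.+1%:R + N)^-1 ^+ 2.
have N0 : 0 < N by rewrite divr_gt0 // divr_gt0.
have n0 t : 0 < t.+1%:R :> R by rewrite ltr0n.
have nN t : 0 < t.+1%:R + N by rewrite addr_gt0.
have tauE t : tau t = t.+1%:R^-1 by exact: power_decay1.
suff [K K0 gle] : exists2 K, 0 <= K & forall t, g t <= K * r t.
  exists K => // t; apply: le_trans (gle t) _; rewrite ler_wpM2l // tauE /r.
  rewrite ler_pXn2r ?nnegrE ?invr_ge0 ?(ltW (nN t)) ?(ltW (n0 t)) //.
  by rewrite lef_pV2 ?posrE // lerDl ltW.
pose A := (Lxx / 2 + Lyx ^+ 2 / (2 * mu) + Lyx ^+ 2 / (mu * c)) * D ^+ 2.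
have A_ge0 : 0 <= A by rewrite /A; nonneg.
apply: (@perturbed_contraction _ g (fun=> 1) r (c / 2) (A * (1 + N) ^+ 2)) => //.
- exact: divr_gt0.
- by rewrite mulr_ge0 // sqr_ge0.
- by move=> _; have := c_le1; lra.
- by move=> t; rewrite exprn_gt0 ?invr_gt0.
- move=> t; have := dual_gap_seq_step HS HX Hrun (power_decay1_gt0 R)
    (power_decay1_le1 R) (fun=> lexx 0) (fun=> lexx 0) (fun=> mu_gt0) (fun=> mu_le)
    (fun=> c_gt0) (fun=> c_le1) (fun=> c_le) XD YD t.
  rewrite -/(g t) -/(g t.+1) -/tau subrr !mul0r addr0 mulr1 => /le_trans; apply.
  rewrite lerD2l mul1r.
  have -> : (Lxx / 2 + Lyx ^+ 2 / (2 * mu) + Lyx ^+ 2 / (mu * c)) *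
    (tau t ^+ 2 * D ^+ 2) = A * tau t ^+ 2 by rewrite /A; ring.
  rewrite -mulrA ler_wpM2l // /r tauE -exprMn.
  rewrite ler_pXn2r ?nnegrE ?mulr_ge0 ?invr_ge0 ?addr_ge0 ?(ltW N0) ?(ltW (n0 t)) //.
  rewrite ler_pdivlMr // mulrC ler_pdivrMr //.
  have : 1 <= t.+1%:R :> R by rewrite ler1n.
  by have := N0; nra.
- move=> t; rewrite mul1r.
  by apply: shifted_inverse_square_slow_decay; exact: divr_gt0.
Qed.

(** The choice r = 1 / tau equalizes the error terms r tau ^ 2 and 1 / r. *)
Lemma strongly_concave_opt_gap_step K : 0 <= K ->
  (forall t, g t <= K * tau t ^+ 2) ->
  exists2 B, 0 <= B &
    forall t, h t.+1 <= (1 - tau t) * h t + tau t * (B * tau t).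
Proof.
move=> K0 gtau.
exists (2 * K + Lyx ^+ 2 / (2 * mu) * D ^+ 2
  + (Lxx / 2 + Lyx ^+ 2 / (2 * mu)) * D ^+ 2); first by nonneg.
move=> t.
have tau0 : 0 < tau t := power_decay1_gt0 R t.
have tau1 : tau t <= 1 := power_decay1_le1 R t.
have r0 : 0 < (tau t)^-1 by rewrite invr_gt0.
have := opt_gap_seq_step HS HX Hrun (power_decay1_gt0 R) (power_decay1_le1 R)
  (fun=> lexx 0) (fun=> lexx 0) (fun=> mu_gt0) (fun=> mu_le) XD YD t r0.
rewrite -/(h t) -/(h t.+1) -/(g t) -/tau subrr !mul0r addr0 => /le_trans; apply.
rewrite -!addrA lerD2l.
have -> : tau t * ((2 * K + (Lyx ^+ 2 / (2 * mu) * D ^+ 2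
    + (Lxx / 2 + Lyx ^+ 2 / (2 * mu)) * D ^+ 2)) * tau t) =
  tau t * (2 * K * tau t + Lyx ^+ 2 / (2 * mu) * D ^+ 2 * tau t)
    + tau t ^+ 2 * ((Lxx / 2 + Lyx ^+ 2 / (2 * mu)) * D ^+ 2) by ring.
rewrite lerD2r ler_pM2l //; apply: lerD.
  have r1 : 0 <= 1 + (tau t)^-1 by rewrite addr_ge0 // ltW.
  apply: le_trans (ler_wpM2l r1 (gtau t)) _.
  have -> : (1 + (tau t)^-1) * (K * tau t ^+ 2) = K * (tau t * tau t + tau t).
    by field; rewrite gt_eqF.
  have -> : 2 * K * tau t = K * (tau t + tau t) by ring.
  by rewrite ler_wpM2l // lerD2r ler_piMr // ltW.
have -> // : Lyx ^+ 2 / (2 * mu * (tau t)^-1) * D ^+ 2 =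
  Lyx ^+ 2 / (2 * mu) * D ^+ 2 * tau t by field; rewrite !gt_eqF.
Qed.

Lemma strongly_concave_rates :
  rate_Otilde (fun T => gap_opt X Y L (x T)) (fun T => T%:R^-1) /\
  rate_O (average (fun t => gap_dual Y L (x t) (y t))) (fun T => T%:R^-1).
Proof.
have [K K0 gtau] := strongly_concave_dual_gap.
split.
  have [B B0 hstep] := strongly_concave_opt_gap_step K0 gtau.
  exists (B * 3), 1%N => -[//|t] _.
  rewrite expr1; apply: le_trans (gap_opt_le HS Hrun (power_decay1_gt0 R)
    (power_decay1_le1 R) (fun=> lexx 0) YD t.+1) _.
  rewrite !mul0r addr0 -/(h t.+1).
  apply: le_trans (averaging_recursion hstep t) _.
  rewrite -!mulrA ler_wpM2l // mulrC mulrA ler_pM2r ?invr_gt0 ?ltr0n //.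
  by rewrite addn2; exact: harmonic_sum_le_ln.
exists K => -[//|t] _.
have Gp k : gap_dual Y L (x k.+1) (y k.+1) <= K * tau k.+1 ^+ 2.
  apply: le_trans (gap_dual_le HS Hrun (power_decay1_gt0 R)
    (power_decay1_le1 R) (fun=> lexx 0) YD k.+1) _.
  by rewrite !mul0r addr0; exact: gtau.
apply: le_trans (average_le (u := fun k => gap_dual Y L (x k) (y k)) Gp t) _.
by rewrite ler_wpM2l // ler_piMr ?invr_ge0 // inverse_square_sum_le1.
Qed.

End Strongly_concave.

Theorem theorem3p2 (R : realType) (dx dy : nat)
    (X : set 'rV[R]_dx) (Y : set 'rV[R]_dy)
    (L : 'rV[R]_dx -> 'rV[R]_dy -> R) (mu Lxx Lyy Lyx : R) :
  standing_assumption X Y L mu Lxx Lyy Lyx ->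
  convex_concave X Y L ->
  (forall (C : R) (x : nat -> 'rV[R]_dx) (y : nat -> 'rV[R]_dy),
    0 < C ->
    lmo_po_run X Y L Lyy (power_decay 1) (fun t => C * power_decay (1 / 3) t)
      x y ->
    rate_Otilde (fun T => gap_opt X Y L (x T))
      (fun T => T%:R `^ (- (1 / 3))) /\
    rate_O (average (fun t => gap_dual Y L (x t) (y t)))
      (fun T => T%:R `^ (- (1 / 3)))) /\
  (forall (x : nat -> 'rV[R]_dx) (y : nat -> 'rV[R]_dy),
    0 < mu ->
    lmo_po_run X Y L Lyy (power_decay 1) (fun=> 0) x y ->
    rate_Otilde (fun T => gap_opt X Y L (x T)) (fun T => T%:R^-1) /\
    rate_O (average (fun t => gap_dual Y L (x t) (y t)))
      (fun T => T%:R^-1)).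
Proof.
move=> HS [HX _].
have [Dx Dx0 XDx] := compact_enorm_bounded (X_compact HS).
have [Dy Dy0 YDy] := compact_enorm_bounded (Y_compact HS).
have XD u v : X u -> X v -> enorm (u - v) <= Dx + Dy.
  by move=> Xu Xv; apply: le_trans (XDx u v Xu Xv) _; rewrite lerDl ltW.
have YD u v : Y u -> Y v -> enorm (u - v) <= Dx + Dy.
  by move=> Yu Yv; apply: le_trans (YDy u v Yu Yv) _; rewrite lerDr ltW.
split=> [C x y C0 Hrun|x y mu0 Hrun].
- exact (vanishing_regularization_rates HS HX C0 Hrun XD YD).
- exact (strongly_concave_rates HS HX mu0 Hrun XD YD).
Qed.
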